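(* As $n\to\infty$, \[ F(n)\ge h_{\mathbb P}(n)\ge n\exp\!\left( \left(\frac{\log 2}{2}-o(1)\right) \frac{\log n}{\log\log n} \right). \]
   Context: For an integer $m$ and a positive integer $H$, write $I(m,H):=\{m+1,\dots,m+H\}$. For an integer $n\ge1$, $F(n)$ is the least positive integer $H$ such that, for every $m\in\mathbb Z$, the set $I(m,H)$ contains pairwise distinct integers $a_1,\dots,a_n$ satisfying $i\mid a_i$ for all $1\le i\le n$. Similarly, $h_{\mathbb P}(n)$ is the least positive integer $H$ such that, for every $m\in\mathbb Z$, the set $I(m,H)$ contains pairwise distinct integers $a_p$, one for each prime $p\le n$, satisfying $p\mid a_p$ for every prime $p\le n$. The second inequality means: for every $\varepsilon>0$ there is $n_0$ such that for all $n\ge n_0$, $h_{\mathbb P}(n)\ge n\exp\left(\left(\frac{\log 2}{2}-\varepsilon\right)\frac{\log n}{\log\log n}\right)$. Here $\log$ is the natural logarithm. *)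

(* Defs.v *)
From mathcomp Require Import all_boot all_order all_algebra.
From mathcomp Require Import boolp.
From mathcomp Require Import zify.

Set Implicit Arguments.
Unset Strict Implicit.
Unset Printing Implicit Defensive.

Import Order.TTheory GRing.Theory Num.Theory.
Local Open Scope ring_scope.

Definition consecutive (m : int) (H : nat) : {pred int} :=
  [pred a | m + 1 <= a <= m + H%:Z].

(* The set [consecutive m H] contains distinct multiples [a i] of the indices [i]
   satisfying [S]; the values of [a] outside [S] are irrelevant. *)
Definition distinct_multiples (S : pred nat) (m : int) (H : nat) : Prop :=
  exists a : nat -> int,
    [/\ {in S, forall i, a i \in consecutive m H},
        {in S &, injective a}
      & {in S, forall i, (i%:Z %| a i)%Z}].

Definition admissible (S : pred nat) (H : nat) : Prop :=
  (0 < H)%N /\ forall m : int, distinct_multiples S m H.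

Definition upto (n : nat) : pred nat := [pred i | (1 <= i <= n)%N].

Definition primes_upto (n : nat) : pred nat := [pred p | prime p & (p <= n)%N].

Lemma admissible_sub (S T : pred nat) (H : nat) :
  {subset S <= T} -> admissible T H -> admissible S H.
Proof.
move=> sST [H0 HT]; split=> // m; have [a [aI ainj adv]] := HT m.
exists a; split=> [i /sST/aI//|i j /sST iT /sST jT|i /sST/adv//].
exact: ainj.
Qed.

(* The multiple of [i] is taken in the [i]-th of [n.+1] consecutive blocks of
   length [n.+1]. *)
Lemma admissible_upto (n : nat) : admissible (upto n) (n.+1 * n.+1)%N.
Proof.
split=> // m.
pose b (i : nat) : int := m + (i * n.+1)%:Z.
have bP (i : nat) : i \in upto n ->
    [/\ b i < (b i %/ i%:Z)%Z * i%:Z + i%:Z,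
        (b i %/ i%:Z)%Z * i%:Z + i%:Z <= b i + n.+1%:Z & (i <= n)%N].
  rewrite inE => /andP[i1 iN].
  have i0 : (i%:Z != 0) by lia.
  have := divz_eq (b i) i%:Z; have := modz_ge0 (b i) i0.
  have : (b i %% i%:Z)%Z < i%:Z by apply: ltz_pmod; lia.
  by split=> //; lia.
exists (fun i => (b i %/ i%:Z)%Z * i%:Z + i%:Z); split.
- move=> i /bP[]; rewrite inE /b => h1 h2 h3; apply/andP; split; nia.
- move=> i j /bP[h1 h2 h3] /bP[k1 k2 k3] e.
  rewrite e in h1 h2; move: h1 h2 k1 k2; set x := _ + _; rewrite /b; nia.
- by move=> i _; apply: rpredD; [exact: dvdz_mull | exact: dvdzz].
Qed.

Lemma admissible_primes_upto (n : nat) :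
  admissible (primes_upto n) (n.+1 * n.+1)%N.
Proof.
apply: admissible_sub (admissible_upto n) => p; rewrite !inE => /andP[pp ->].
by rewrite prime_gt0.
Qed.

Lemma ex_admissible_upto (n : nat) : exists H, `[< admissible (upto n) H >].
Proof. by exists (n.+1 * n.+1)%N; apply/asboolP/admissible_upto. Qed.

Lemma ex_admissible_primes_upto (n : nat) :
  exists H, `[< admissible (primes_upto n) H >].
Proof. by exists (n.+1 * n.+1)%N; apply/asboolP/admissible_primes_upto. Qed.

Definition F (n : nat) : nat := ex_minn (ex_admissible_upto n).

Definition hP (n : nat) : nat := ex_minn (ex_admissible_primes_upto n).

(* Main.v *)
Require Import Defs.
From mathcomp Require Import all_boot all_order all_algebra.
From mathcomp Require Import boolp reals sequences exp.
From mathcomp Require Import zify ring lra.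

(* Let Q be a product of k odd primes q. By the Chinese remainder theorem, m can
   be chosen so that, for every prime p with Q <= p <= n, the multiples of p in
   I(m,H) are the m + r_p + j p with r_p = p^2 modulo Q. For fixed j the
   polynomial x^2 + j x takes only (q + 1)/2 values modulo q, so the positions
   r_p + j p fill about a proportion 2^-k of the residue classes modulo Q. For
   H = n K and p > n / (16 ln n), only O(K ln n) values of j occur, so all these
   multiples together number O(K^2 n 2^-k ln n). The primes in question are at
   least n / (16 ln n) in number, so if the multiples a_p exist then K^2 is at
   least 2^k up to a factor (ln n)^2. Taking k as close to ln n / ln (ln n) as
   Q <= n / (16 ln n) permits gives the bound. *)

Import Order.TTheory GRing.Theory Num.Theory.

(** * Chinese remaindering and residues of quadratic polynomials *)

Lemma coprime_prod_seq (a : nat) (s : seq nat) :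
  all (coprime a) s -> coprime a (\prod_(b <- s) b).
Proof.
elim: s => [|b s IH] /=; first by rewrite big_nil coprimen1.
by move=> /andP[ab /IH]; rewrite big_cons coprimeMr ab.
Qed.

Lemma pairwise_coprime_primes {s : seq nat} :
  uniq s -> all prime s -> pairwise coprime s.
Proof.
elim: s => //= q s IH /andP[qs us] /andP[pq ps]; rewrite IH // andbT.
apply/allP => r rs; rewrite prime_coprime // dvdn_prime2 //; last exact: (allP ps).
by apply: contraNneq qs => ->.
Qed.

Lemma chinese_seq (g : nat -> nat) {s : seq nat} : pairwise coprime s ->
  exists m : nat, {in s, forall q, m = g q %[mod q]}.
Proof.
elim: s => [|q s IH] /=; first by exists 0.
move=> /andP[/coprime_prod_seq coqs /IH[m hm]].
exists (chinese q (\prod_(b <- s) b) (g q) m) => r.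
rewrite inE => /predU1P[->|rs]; first by rewrite chinese_modl.
have rQ : r %| \prod_(b <- s) b by rewrite (big_rem r rs) dvdn_mulr.
by rewrite -(modn_dvdm _ rQ) chinese_modr // modn_dvdm // hm.
Qed.

(** A residue modulo the product is the Chinese combination of its residues modulo the factors, so
    [L] lists the combinations of one allowed residue per factor. *)
Lemma residues_prod (S : nat -> seq nat) {s : seq nat} : pairwise coprime s ->
  exists2 L : seq nat, size L = \prod_(q <- s) size (S q) &
    forall x, {in s, forall q, x %% q \in S q} -> x %% (\prod_(q <- s) q) \in L.
Proof.
elim: s => [|q s IH] /=.
  by exists [:: 0] => [|x _]; rewrite big_nil // modn1.
move=> /andP[/coprime_prod_seq coqs /IH[L sL hL]].
exists [seq chinese q (\prod_(b <- s) b) a b %% (q * \prod_(b <- s) b)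
         | a <- S q, b <- L].
  by rewrite size_allpairs sL big_cons.
move=> x xS; rewrite big_cons (chinese_mod coqs).
apply/allpairsP; exists (x %% q, x %% \prod_(b <- s) b); split => //=.
  by apply: xS; rewrite mem_head.
by apply: hL => r rs; apply: xS; rewrite inE rs orbT.
Qed.

(* For odd q, completing the square in x^2 + j x modulo q gives t^2 - i^2 with
   2 i = j, and t and -t have the same square. *)
Lemma quadratic_residues (q j : nat) : odd q ->
  exists2 S : seq nat, size S = q.+1./2 &
    forall x, (x * x + j * x) %% q \in S.
Proof.
move=> oq; have q0 : 0 < q by case: q oq.
(* As (q + 1)/2 inverts 2 modulo q, [i] is half of j; [c] is a natural number congruent to - i^2. *)
pose i := j * q.+1./2; move c_def: (q.-1 * (i * i)) => c.
exists [seq (y * y + c) %% q | y <- iota 0 q.+1./2].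
  by rewrite size_map size_iota.
move=> x.
have e2 : 2 * q.+1./2 = q.+1 by lia.
pose t := (x + i) %% q; have tq : t < q by rewrite ltn_mod.
have et : x * x + j * x = t * t + c %[mod q].
  rewrite -(modnDml (t * t)) modnMm modnDml.
  have e3 : 2 * (x * i) = x * j * q.+1 by rewrite -e2 /i; ring.
  have -> : (x + i) * (x + i) + c = (j * x + i * i) * q + (x * x + j * x).
    have -> : (x + i) * (x + i) + c = 2 * (x * i) + (x * x + q * (i * i)).
      by rewrite -c_def -[in RHS](prednK q0); ring.
    by rewrite e3; ring.
  by rewrite modnMDl.
rewrite et; case: (leqP q.+1./2 t) => ht; last first.
  by apply: (map_f (fun y => (y * y + c) %% q)); rewrite mem_iota.
(* Here t lies in the upper half, so q - t falls below (q + 1)/2 and has the same square modulo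
   q. *)
have -> : t * t + c = (q - t) * (q - t) + c %[mod q].
  rewrite -[LHS](modnMDl (q - t)) -[RHS](modnMDl t); congr (_ %% _).
  have [d ->] : exists d, q = t + d by exists (q - t); lia.
  by rewrite addKn; ring.
by apply: (map_f (fun y => (y * y + c) %% q)); rewrite mem_iota; lia.
Qed.

(** * Chebyshev's lower bound for the number of primes *)

Definition primes_in (a b : nat) : seq nat := [seq p <- index_iota a.+1 b.+1 | prime p].

Lemma mem_primes_in (a b p : nat) :
  (p \in primes_in a b) = [&& prime p, a < p & p <= b].
Proof. by rewrite mem_filter mem_index_iota. Qed.

Lemma primes_in_uniq (a b : nat) : uniq (primes_in a b).
Proof. by rewrite filter_uniq // iota_uniq. Qed.

Lemma size_primes_in (a b : nat) : size (primes_in 0 b) <= a + size (primes_in a b).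
Proof.
rewrite -[a in a + _](size_iota 1) -size_cat.
apply: uniq_leq_size => [|p]; first exact: primes_in_uniq.
by rewrite mem_cat !mem_primes_in mem_iota => /and3P[-> /= -> ->]; lia.
Qed.

Lemma exp2_leq_bin (n : nat) : 2 ^ n <= 'C(2 * n, n).
Proof.
elim: n => // n IH; rewrite expnS (leq_trans (leq_mul (leqnn 2) IH)) //.
rewrite mulnS !addSn add0n !binS.
by have := leq_bin2l n (leqnSn (2 * n)); lia.
Qed.

(** By Legendre's formula the exponent of p is the sum over k of floor(2n/p^k) - 2 floor(n/p^k).
    Each term is at most 1 and vanishes once p^k > 2n, so the exponent is at most [T]. *)
Lemma expn_logn_bin {p n : nat} : prime p -> 0 < n ->
  p ^ logn p 'C(2 * n, n) <= 2 * n.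
Proof.
move=> pp n0; have p1 := prime_gt1 pp; set T := trunc_log p (2 * n).
apply: leq_trans (trunc_logP p1 _); last by lia.
rewrite leq_exp2l // -/T.
have le2 : n <= 2 * n by lia.
have := congr1 (logn p) (bin_fact le2).
have -> : 2 * n - n = n by rewrite mul2n -addnn addnK.
rewrite !lognM ?fact_gt0 ?bin_gt0 ?muln_gt0 ?fact_gt0 //.
(* The sum for n! is extended by zero terms to the range of the sum for (2n)!, so that the two
   compare term by term. *)
have -> : logn p n`! = \sum_(1 <= k < (2 * n).+1) n %/ p ^ k.
  rewrite logn_fact // [RHS](big_cat_nat (n := n.+1)) //=.
  rewrite [X in _ = _ + X]big1_seq ?addn0 // => k.
  rewrite mem_index_iota => /= hk; apply: divn_small.
  by apply: leq_trans (ltn_expl k p1); lia.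
rewrite logn_fact //.
have sumT M : \sum_(1 <= k < M.+1) (k <= T : nat) <= minn M T.
  elim: M => [|M IH]; first by rewrite big_geq.
  by rewrite big_nat_recr //=; lia.
have : \sum_(1 <= k < (2 * n).+1) 2 * n %/ p ^ k <=
   \sum_(1 <= k < (2 * n).+1) ((k <= T) + (n %/ p ^ k + n %/ p ^ k)).
  apply: leq_sum => k _; have [kT|kT] := leqP k T.
    have d0 : 0 < p ^ k by rewrite expn_gt0 prime_gt0.
    rewrite -ltnS ltn_divLR //.
    have := divn_eq n (p ^ k); have := ltn_pmod n d0; nia.
  rewrite divn_small //; apply: leq_trans (trunc_log_ltn (2 * n) p1) _.
  by rewrite leq_exp2l.
rewrite !big_split /=; have := sumT (2 * n).
by set u := \sum_(_ <= _ < _ ) _; set v := \sum_(_ <= _ < _ ) _; lia.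
Qed.

(** The central binomial coefficient is a product of prime powers, each at most 2n, over distinct
    primes up to 2n. *)
Lemma exp2_leq_primes_in (n : nat) : 0 < n ->
  2 ^ n <= (2 * n) ^ size (primes_in 0 (2 * n)).
Proof.
move=> n0; apply: leq_trans (exp2_leq_bin n) _.
set B := 'C(2 * n, n); have B0 : 0 < B by rewrite bin_gt0; lia.
rewrite [B]prod_prime_decomp // prime_decompE big_map /=.
have le_pr : size (primes B) <= size (primes_in 0 (2 * n)).
  apply: uniq_leq_size => [|p]; first exact: primes_uniq.
  rewrite mem_primes_in mem_primes => /and3P[pp _ pB]; rewrite pp prime_gt0 //=.
  apply: leq_trans (expn_logn_bin pp n0); rewrite -{1}(expn1 p).
  by rewrite leq_exp2l ?prime_gt1 // logn_gt0 mem_primes pp B0.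
apply: (@leq_trans ((2 * n) ^ size (primes B))); last first.
  by rewrite leq_pexp2l //; lia.
have : all prime (primes B) by apply/allP => p; rewrite mem_primes => /andP[].
rewrite -/B; elim: (primes B) => [|p s IH] /=; first by rewrite big_nil.
move=> /andP[pp /IH les]; rewrite big_cons expnS leq_mul //.
exact: expn_logn_bin.
Qed.

(** * Counting positions of multiples in an interval *)

Lemma hP_admissible (n : nat) : admissible (primes_upto n) (hP n).
Proof. by rewrite /hP; case: ex_minnP => H /asboolP. Qed.

Lemma hP_leq_F (n : nat) : hP n <= F n.
Proof.
rewrite /hP; case: ex_minnP => H _; apply; apply/asboolP.
rewrite /F; case: ex_minnP => {}H /asboolP adm _.
apply: admissible_sub adm => p; rewrite !inE => /andP[pp ->].
by rewrite prime_gt0.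
Qed.

Lemma quadratic_residues_prod (j : nat) {s : seq nat} :
  pairwise coprime s -> all odd s ->
  exists2 L : seq nat, size L = \prod_(q <- s) q.+1./2 &
    forall x r, {in s, forall q, x = r * r + j * r %[mod q]} ->
      x %% \prod_(q <- s) q \in L.
Proof.
move=> cos odds.
have /boolp.choice[S hS] q : exists S : seq nat, odd q ->
    size S = q.+1./2 /\ forall x, (x * x + j * x) %% q \in S.
  by case: (boolP (odd q)) => [/(quadratic_residues q j)[S]|]; [exists S | exists [::]].
have [L sL hL] := residues_prod S cos.
exists L => [|x r xr].
  by rewrite sL; apply: eq_big_seq => q qs; case: (hS q (allP odds q qs)).
by apply: hL => q qs; rewrite xr //; case: (hS q (allP odds q qs)).
Qed.

Lemma admissible_primes_bound (n H J : nat) (s P : seq nat) :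
  admissible (primes_upto n) H ->
  pairwise coprime s -> all odd s ->
  uniq P -> all prime P ->
  {in P, forall p, [/\ p <= n, \prod_(q <- s) q <= p & H <= J * p]} ->
  size P <= J * ((H %/ \prod_(q <- s) q).+1 * \prod_(q <- s) q.+1./2).
Proof.
move=> [_ adm] cos odds uP prP hP'; set Q := \prod_(q <- s) q.
have Q0 : 0 < Q.
  rewrite /Q big_seq; apply: prodn_cond_gt0 => q qs.
  by have := allP odds q qs; case: q {qs}.
(* The representative of p^2 modulo Q in {1, ..., Q}. *)
pose r p := if (p * p) %% Q == 0 then Q else (p * p) %% Q.
have rQ p : 0 < r p <= Q.
  by rewrite /r; case: eqP => h; rewrite ?Q0 ?leqnn // lt0n (introF eqP h) ltnW ?ltn_mod.
have rE p : r p = p * p %[mod Q].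
  by rewrite /r; case: eqP => [->|_]; rewrite ?modnn ?modn_mod.
(* The subtraction is not truncated since [r p] <= Q <= p; thus p divides m + [r p]. *)
have [m hm] := chinese_seq (fun p => p - r p) (pairwise_coprime_primes uP prP).
have [a [aI ainj adv]] := adm (Posz m).
have /boolp.choice[L hL] j : exists L : seq nat,
    size L = \prod_(q <- s) q.+1./2 /\
    forall x r, {in s, forall q, x = r * r + j * r %[mod q]} -> x %% Q \in L.
  by have [L] := quadratic_residues_prod j cos odds; exists L.
pose T j := [seq u * Q + v | u <- iota 0 (H %/ Q).+1, v <- L j].
have aP p : p \in P -> exists x : nat, exists j : nat,
    [/\ a p = (m%:Z + x%:Z)%R, j < J & x \in T j].
  move=> pP; have [pn Qp HJ] := hP' p pP; have prp := allP prP p pP.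
  have pS : p \in primes_upto n by rewrite inE prp.
  have := aI p pS; have := adv p pS.
  rewrite inE => /dvdzP[b ab] /andP[lo hi].
  have [x ax] : exists x : nat, a p = (m%:Z + x%:Z)%R by exists `|(a p - m%:Z)%R|; lia.
  have x0 : 0 < x <= H by lia.
  have rp : 0 < r p <= Q := rQ p.
  have pmr : p %| m + r p.
    rewrite /dvdn -modnDml hm // modnDml subnK ?modnn //; lia.
  have pmx : p %| m + x.
    by have := dvdz_mull b (dvdzz (Posz p)); rewrite -ab ax -PoszD.
  (* The position [r p] is the first multiple of p after m: an earlier one would make p divide a
     number strictly between 0 and p. *)
  have [xr|rx] := ltnP x (r p).
    have := dvdn_sub pmr pmx; rewrite subnDl => /dvdn_leq; lia.
  have := dvdn_sub pmx pmr; rewrite subnDl => /dvdnP[j xj].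
  have xE : x = r p + j * p by lia.
  exists x, j; split => //.
    (* Since [r p] is positive, j p < x <= H <= J p. *)
    by rewrite -(ltn_pmul2r (prime_gt0 prp)); lia.
  apply/allpairsP; exists (x %/ Q, x %% Q); split; last exact: divn_eq.
    by rewrite mem_iota /= ltnS leq_div2r //; lia.
  apply: ((hL j).2 x p) => q qs; rewrite xE.
  have qQ : q %| Q by rewrite /Q (big_rem q qs) dvdn_mulr.
  by rewrite -modnDml -(modn_dvdm (r p) qQ) rE (modn_dvdm _ qQ) modnDml.
have : {subset [seq absz (a p) | p <- P] <= [seq m + x | j <- iota 0 J, x <- T j]}.
  move=> _ /mapP[p pP ->]; have [x [j [-> jJ xT]]] := aP p pP.
  apply/allpairsPdep; exists j, x; split => //; rewrite ?mem_iota //; lia.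
move=> /uniq_leq_size; rewrite map_inj_in_uniq => [/(_ uP)|p q pP qP e].
  rewrite size_map size_allpairs_dep => /leq_trans; apply.
  rewrite sumnE big_map (eq_bigr _ (fun j _ => size_allpairs _ _ _)).
  rewrite (eq_bigr (fun=> (H %/ Q).+1 * \prod_(q <- s) q.+1./2)) => [|j _].
    by rewrite big_const_seq count_predT size_iota iter_addn_0 mulnC.
  by rewrite size_iota (hL j).1.
have [x [j [ep _ _]]] := aP p pP; have [y [k [eq _ _]]] := aP q qP.
have inS u : u \in P -> u \in primes_upto n.
  by move=> uP'; rewrite inE (allP prP u uP') /=; case: (hP' u uP').
by apply: ainj; rewrite ?inS //; lia.
Qed.

(** * Real estimates and the choice of the moduli *)

Local Open Scope ring_scope.

Lemma ln2_bounds (R : realType) : 1 / 2 <= (ln 2 : R) <= 1.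
Proof.
apply/andP; split; last first.
  by have := @le_ln1Dx R 1; rewrite -[1 + 1]/(2%:R); apply; lra.
have : ln (1 + (- (1 / 2))) <= - (1 / 2) :> R by apply: le_ln1Dx; lra.
have -> : 1 + - (1 / 2) = 2^-1 :> R by field.
by rewrite lnV ?posrE; lra.
Qed.

(** With n = floor(N/2), N <= 3 n and ln 2 >= 1/2, taking logarithms in [exp2_leq_primes_in] gives
    the constant 6, rounded up to 8. *)
Lemma primes_in_ge (R : realType) (N : nat) : (2 <= N)%N ->
  N%:R <= 8 * ln N%:R * (size (primes_in 0 N))%:R :> R.
Proof.
move=> N2; set n := N./2.
have n0 : (0 < n)%N by rewrite /n; lia.
have le_pi : (size (primes_in 0 (2 * n)) <= size (primes_in 0 N))%N.
  apply: uniq_leq_size => [|p]; first exact: primes_in_uniq.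
  by rewrite !mem_primes_in => /and3P[-> -> /=]; rewrite /n; lia.
have pow_le : (2 ^ n <= N ^ size (primes_in 0 N))%N.
  apply: leq_trans (exp2_leq_primes_in n n0) _.
  apply: leq_trans (leq_pexp2l _ le_pi) _; first by lia.
  by case: (size _) => // e; rewrite leq_exp2r // /n; lia.
have N0 : 0 < N%:R :> R by rewrite ltr0n; lia.
have : ln (2 ^ n)%:R <= ln (N ^ size (primes_in 0 N))%:R :> R.
  by rewrite ler_ln ?posrE ?ltr0n ?ler_nat ?expn_gt0 ?(ltnW N2).
rewrite !natrX !lnXn ?ltr0n ?(ltnW N2) // -(mulr_natl (ln 2)) -(mulr_natl (ln N%:R)).
have /andP[ln2 _] := ln2_bounds R.
have : N%:R <= 3 * n%:R :> R by rewrite -natrM ler_nat /n; lia.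
have : n%:R * (1 / 2) <= n%:R * ln 2 :> R by rewrite ler_wpM2l.
by lra.
Qed.

(** At most k of the 2 k primes are <= k, so k primes q > k remain. For these (q + 1)/2 <= (q/2)
    exp(1/k), and the k correction factors multiply to at most e. *)
Lemma exists_moduli (R : realType) (k z : nat) :
  (2 <= k)%N -> (2 * k <= size (primes_in 0 z))%N ->
  exists s : seq nat, [/\ pairwise coprime s, all odd s,
    (0 < \prod_(q <- s) q <= z ^ k)%N &
    (\prod_(q <- s) q.+1./2)%:R
      <= (\prod_(q <- s) q)%:R * expR (1 - k%:R * ln 2) :> R].
Proof.
move=> k2 hk; have le_sz := size_primes_in k z.
pose s := take k (primes_in k z).
have sz : size s = k by rewrite size_takel //; lia.
have sP q : q \in s -> [&& prime q, k < q & q <= z]%N.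
  by move=> /mem_take; rewrite mem_primes_in.
have k0 : 0 < k%:R :> R by rewrite ltr0n; lia.
exists s; split.
- apply: pairwise_coprime_primes; first by rewrite take_uniq ?primes_in_uniq.
  by apply/allP => q /sP/and3P[].
- apply/allP => q /sP/and3P[pq kq _]; have := even_prime pq; lia.
- rewrite -sz; elim: s sP {sz} => [|q s IH] sP; first by rewrite big_nil.
  rewrite big_cons expnS; have /and3P[pq _ qz] := sP q (mem_head _ _).
  have /IH/andP[? ?] r : r \in s -> [&& prime r, k < r & r <= z]%N.
    by move=> rs; apply: sP; rewrite inE rs orbT.
  by rewrite muln_gt0 prime_gt0 //= leq_mul // andbT.
have -> : 1 - k%:R * ln 2 = (size s)%:R * (k%:R^-1 - ln 2) :> R.
  by rewrite sz; field; rewrite gt_eqF.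
rewrite expRM_natl; elim: s sP {sz} => [|q s IH] sP.
  by rewrite !big_nil expr0 mul1r.
rewrite !big_cons exprS !natrM mulrACA.
have /and3P[pq kq _] := sP q (mem_head _ _).
have /IH {}IH r : r \in s -> [&& prime r, k < r & r <= z]%N.
  by move=> rs; apply: sP; rewrite inE rs orbT.
apply: ler_pM => //; rewrite expRB lnK ?posrE //.
have h : 2 * q.+1./2%:R = q%:R + 1 :> R.
  rewrite -natrM natr1; congr _%:R; have := even_prime pq; lia.
have : q%:R * (1 + k%:R^-1) <= q%:R * expR (k%:R^-1) :> R.
  by rewrite ler_wpM2l // expR_ge1Dx.
have : 1 <= q%:R * k%:R^-1 :> R by rewrite ler_pdivlMr // mul1r ler_nat; lia.
by lra.
Qed.

Lemma expR_ge2 (R : realType) (x : R) : 0 <= x -> x ^+ 2 / 2 <= expR x.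
Proof. by move=> /(expR_ge1Dxn 1); rewrite (_ : 2`! = 2)%N //; lra. Qed.

Lemma expR_ge3 (R : realType) (x : R) : 0 <= x -> x ^+ 3 / 6 <= expR x.
Proof.
by move=> /(expR_ge1Dxn 2); rewrite (_ : 3`! = 6)%N //; lra.
Qed.

(** Gathers what it takes for [lam] to be large: the first bound supplies enough primes for the
    moduli, the second makes their product small enough, the third absorbs the constants and powers
    of ln n at the end. *)
Lemma expR_growth (R : realType) (eps lam : R) :
  0 < eps -> eps <= 1 / 4 -> 128 <= eps ^+ 2 * lam ->
  [/\ 64 * lam <= expR (eps * lam), 4 + lam <= eps ^+ 2 * expR lam,
      (12 + 2 * lam) * lam < eps * expR lam & 128 <= lam].
Proof.
move=> e0 e4 hl.
have el : 512 <= eps * lam.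
  have : eps * (eps * lam) <= 1 / 4 * (eps * lam).
    by rewrite ler_wpM2r //; nra.
  by lra.
have lam2 : 2048 <= lam.
  have : eps * lam <= 1 / 4 * lam by rewrite ler_wpM2r //; nra.
  by lra.
have h0 : 128 * lam <= eps ^+ 2 * lam * lam by rewrite ler_wpM2r //; lra.
split.
- have := @expR_ge2 R (eps * lam); rewrite exprMn => /(_ _); lra.
- have : eps ^+ 2 * (lam ^+ 2 / 2) <= eps ^+ 2 * expR lam.
    by rewrite ler_wpM2l ?sqr_ge0 // expR_ge2; lra.
  by lra.
- have : eps * (lam ^+ 3 / 6) <= eps * expR lam.
    by rewrite ler_wpM2l ?expR_ge3; lra.
  have : 512 * lam ^+ 2 <= eps * lam * lam ^+ 2 by rewrite ler_wpM2r ?sqr_ge0.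
  have : 2048 * lam <= lam * lam by rewrite ler_wpM2r //; lra.
  by lra.
- by lra.
Qed.

(** There are at least 2 u primes up to n by [primes_in_ge], and at most u of them are <= u. *)
Lemma size_primes_in_truncn (R : realType) (n : nat) (u : R) :
  (2 <= n)%N -> u = n%:R / (16 * ln n%:R) ->
  u <= (size (primes_in (Num.truncn u) n))%:R.
Proof.
move=> n2 uE; have ln0 : 0 < ln n%:R :> R by rewrite ln_gt0 // ltr1n.
have u0 : 0 <= u by rewrite uE divr_ge0 // mulr_ge0 // ltW.
have := size_primes_in (Num.truncn u) n; rewrite -(ler_nat R) natrD => le_pi.
have le_u : (Num.truncn u)%:R <= u by rewrite truncn_le.
suff : 2 * u <= (size (primes_in 0 n))%:R by lra.
rewrite -(@ler_pM2l _ (8 * ln n%:R)) ?mulr_gt0 //.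
apply: le_trans (primes_in_ge R n n2).
by rewrite uE le_eqVlt; apply/orP; left; apply/eqP; field; rewrite gt_eqF.
Qed.

(* In terms of lam = ln (ln n): the moduli are (1 - eps) ln n / ln (ln n)
   primes up to (ln n)^(1 + eps), so that their product is at most
   n^(1 - eps^2). *)
Lemma exists_good_moduli (R : realType) (eps lam : R) :
  0 < eps -> eps <= 1 / 4 -> 128 <= eps ^+ 2 * lam ->
  exists s : seq nat, [/\ pairwise coprime s, all odd s,
    (0 < \prod_(q <- s) q)%N,
    (\prod_(q <- s) q)%:R <= expR (expR lam) / (16 * expR lam) &
    (\prod_(q <- s) q.+1./2)%:R
      <= (\prod_(q <- s) q)%:R * expR (2 - (ln 2 - eps) * (expR lam / lam)) :> R].
Proof.
move=> e0 e4 hl; have [g1 g2 _ lam1] := expR_growth _ _ _ e0 e4 hl.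
set l := expR lam in g2 *; set w := l / lam.
have l0 : 0 < l by rewrite expR_gt0.
have /andP[ln2_lo ln2_hi] := ln2_bounds R.
have lE : lam * w = l by rewrite /w; field; lra.
have l_lam : 64 * lam <= l.
  apply: le_trans g1 _; rewrite ler_expR -[leRHS]mul1r ler_wpM2r; lra.
have w64 : 64 <= w by rewrite /w ler_pdivlMr; lra.
have wl : w <= l by rewrite -lE ler_peMl; lra.
have zE : expR ((1 + eps) * lam) = l * expR (eps * lam).
  by rewrite mulrDl mul1r expRD.
have l1 : l * 1 <= l * lam by rewrite ler_wpM2l ?(ltW l0) //; lra.
have lg : l * (64 * lam) <= l * expR (eps * lam) by rewrite ler_wpM2l // ltW.
pose k := Num.truncn ((1 - eps) * w).
have /andP[k_lo k_hi] : k%:R <= ((1 - eps) * w : R) < k.+1%:R.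
  by rewrite truncn_itv // mulr_ge0; lra.
rewrite -natr1 in k_hi; clearbody k.
pose z := Num.truncn (expR ((1 + eps) * lam)).
have /andP[z_lo z_hi] : z%:R <= (expR ((1 + eps) * lam) : R) < z.+1%:R.
  by rewrite truncn_itv // expR_ge0.
rewrite -natr1 in z_hi; clearbody z w.
have ew : 0 <= eps * w by rewrite mulr_ge0; lra.
have ew4 : eps * w <= 1 / 4 * w by rewrite ler_wpM2r; lra.
have k2 : (2 <= k)%N by rewrite -(ler_nat R); lra.
have z2 : (2 <= z)%N by rewrite -(ler_nat R); lra.
have ln_z : ln z%:R <= 2 * lam :> R.
  have z0 : 0 < z%:R :> R by rewrite ltr0n ltnW.
  rewrite -ler_expR lnK ?posrE //; apply: le_trans z_lo _.
  by rewrite ler_expR ler_wpM2r; lra.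
(* Since z >= 32 l lam and ln z <= 2 lam, there are at least 2 l >= 2 k primes up to z. *)
have k_pi : (2 * k <= size (primes_in 0 z))%N.
  have := primes_in_ge R z z2; set p := size _ => hp.
  have : 8 * ln z%:R * p%:R <= 8 * (2 * lam) * p%:R :> R.
    by rewrite ler_wpM2r // ler_wpM2l.
  rewrite -(ler_nat R) natrM => h2.
  have : 2 * l * (16 * lam) <= p%:R * (16 * lam) by lra.
  by rewrite ler_pM2r; lra.
have [s [cos odds /andP[Q0 Q_le] prod_le]] := exists_moduli R k z k2 k_pi.
exists s; split => //.
- apply: (@le_trans _ _ (expR ((1 + eps) * lam * k%:R))).
    rewrite expRM_natr (le_trans (_ : _ <= (z ^ k)%:R)) ?ler_nat //.
    by rewrite natrX lerXn2r // nnegrE // expR_ge0.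
  (* The saving eps^2 l in the exponent is at least 4 + lam, which pays for the factor 16 l because
     e^4 >= 16. *)
  apply: (@le_trans _ _ (expR (l - (4 + lam)))).
    rewrite ler_expR.
    have : (1 + eps) * lam * k%:R <= (1 + eps) * lam * ((1 - eps) * w).
      by rewrite ler_wpM2l // mulr_ge0; lra.
    have -> : (1 + eps) * lam * ((1 - eps) * w) = l - eps ^+ 2 * l.
      by rewrite -lE; ring.
    by lra.
  rewrite expRB expRD -/l ler_pM2l ?expR_gt0 // lef_pV2 ?posrE ?mulr_gt0 ?expR_gt0 //.
  rewrite ler_pM2r //.
  have -> : 4 = 1 * 4%:R :> R by rewrite mul1r.
  have -> : 16 = 2 ^+ 4 :> R by rewrite -natrX.
  rewrite expRM_natr lerXn2r ?nnegrE ?expR_ge0 //.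
  by have := expR_ge1Dx (1 : R); lra.
(* Rounding k down costs at most ln 2 <= 1, which turns the 1 of [exists_moduli] into 2. *)
- apply: le_trans prod_le _; rewrite ler_wpM2l // ler_expR.
  have : ((1 - eps) * w - 1) * ln 2 <= k%:R * ln 2 by rewrite ler_wpM2r; lra.
  have : eps * w * ln 2 <= eps * w * 1 by rewrite ler_wpM2l.
  by lra.
Qed.

(** * The lower bound for [hP] *)

Lemma hP_lower_bound (R : realType) (eps lam : R) (n : nat) :
  0 < eps -> eps <= 1 / 4 -> 128 <= eps ^+ 2 * lam ->
  n%:R = expR (expR lam) ->
  n%:R * expR ((ln 2 / 2 - eps) * (expR lam / lam)) <= (hP n)%:R :> R.
Proof.
move=> e0 e4 hl nE; have [_ _ g3 lam1] := expR_growth _ _ _ e0 e4 hl.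
have [s [cos odds Q0 Q_small prod_le]] := exists_good_moduli _ _ _ e0 e4 hl.
set w := expR lam / lam in prod_le *.
have gw : 12 + 2 * lam < eps * w.
  by rewrite /w mulrA ltr_pdivlMr //; lra.
have w0 : 0 <= w by rewrite divr_ge0 ?expR_ge0 //; lra.
have n0 : 0 < n%:R :> R by rewrite nE expR_gt0.
have l1 : 1 <= expR lam by rewrite -expR0 ler_expR; lra.
have ln_n : ln n%:R = expR lam by rewrite nE expRK.
have n2 : (2 <= n)%N.
  by rewrite -(ltr_nat R) nE -[ltLHS]expR0 ltr_expR; lra.
have := size_primes_in_truncn R n _ n2 erefl; rewrite ln_n -nE in Q_small *.
set l := expR lam in l1 Q_small *.
set Q := (\prod_(q <- s) q)%N in Q0 Q_small prod_le.
set u := n%:R / (16 * l) in Q_small *.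
have nu : n%:R = 16 * l * u by rewrite /u; field; lra.
have u0 : 0 < u by rewrite divr_gt0 // mulr_gt0 //; lra.
have y_hi : u < (Num.truncn u).+1%:R by exact: truncnS_gt.
clearbody u; move: (Num.truncn u) y_hi => y y_hi u_le.
have Qy : (Q <= y)%N by rewrite -ltnS -(ltr_nat R) (le_lt_trans Q_small).
rewrite leNgt; apply/negP; set E := expR (_ * w); set H := hP n => H_lt.
have E1 : 1 <= E.
  have /andP[ln2_lo _] := ln2_bounds R.
  by rewrite -expR0 ler_expR mulr_ge0 //; lra.
(* Every prime counted is at least y + 1, so J p >= H. *)
pose J := (H %/ y.+1).+1.
have hP' : {in primes_in y n, forall p, [/\ p <= n, Q <= p & H <= J * p]%N}.
  move=> p; rewrite mem_primes_in => /and3P[_ yp pn]; split => //.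
    exact: leq_trans Qy (ltnW yp).
  apply: leq_trans (leq_mul (leqnn J) yp); rewrite /J.
  exact: ltnW (ltn_ceil _ _).
have prP : all prime (primes_in y n).
  by apply/allP => p; rewrite mem_primes_in => /and3P[].
have := admissible_primes_bound n H J s _ (hP_admissible n) cos odds
  (primes_in_uniq y n) prP hP'.
rewrite -/Q -(ler_nat R) !natrM; apply/negP; rewrite -ltNge.
apply: lt_le_trans u_le.
have lE1 : 1 <= l * E by rewrite mulr_ege1.
(* H < n E = 16 l u E and u < y + 1 bound the quotient by 16 l E; the added 1 is at most l E. *)
have J_le : J%:R <= 17 * (l * E).
  have : (H %/ y.+1)%:R * y.+1%:R <= 16 * (l * E) * y.+1%:R :> R.
    rewrite -natrM (@le_trans _ _ H%:R) ?ler_nat ?leq_trunc_div //.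
    have : l * E * u <= l * E * y.+1%:R by rewrite ler_wpM2l; lra.
    by move: H_lt; rewrite nu; lra.
  by rewrite ler_pM2r ?ltr0n // /J -natr1; lra.
(* The left side is at most H + Q, and Q <= u <= n E. *)
have HQ_le : (H %/ Q).+1%:R * Q%:R <= 2 * (n%:R * E).
  rewrite -natr1 mulrDl mul1r -natrM.
  have : ((H %/ Q) * Q)%:R <= H%:R :> R by rewrite ler_nat leq_trunc_div.
  have : u <= 16 * l * u by rewrite ler_peMl; lra.
  have : n%:R <= n%:R * E by rewrite ler_peMr // ltW.
  by lra.
set X := expR (2 - _) in prod_le.
apply: (@le_lt_trans _ _ (17 * (l * E) * (2 * (n%:R * E) * X))).
  apply: ler_pM => //; first by rewrite mulr_ge0.
  apply: le_trans (ler_wpM2l _ prod_le) _ => //.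
  by rewrite [leLHS]mulrA ler_wpM2r // expR_ge0.
rewrite nu.
have -> : 17 * (l * E) * (2 * (16 * l * u * E) * X) = 544 * (l ^+ 2 * E ^+ 2 * X) * u.
  by ring.
rewrite gtr_pMl //.
(* As 544 <= 2^10 <= e^10, everything becomes a single exponential, with exponent 12 + 2 lam - eps w
   < 0. *)
apply: (@le_lt_trans _ _ (expR 10 * (l ^+ 2 * E ^+ 2 * X))).
  rewrite ler_wpM2r ?mulr_ge0 ?sqr_ge0 ?expR_ge0 //.
  have -> : 10 = 1 * 10%:R :> R by rewrite mul1r.
  rewrite expRM_natr; apply: (@le_trans _ _ (2 ^+ 10)).
    by rewrite -natrX ler_nat.
  by rewrite lerXn2r ?nnegrE ?expR_ge0 //; have := expR_ge1Dx (1 : R); lra.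
rewrite /l /E /X -!expRM_natr -!expRD expR_lt1.
by lra.
Qed.

Theorem theorem1p3 (R : realType) :
  (forall n : nat, (1 <= n)%N -> (hP n <= F n)%N) /\
  (forall eps : R, 0 < eps ->
    exists n0 : nat, forall n : nat, (n0 <= n)%N ->
      n%:R * expR ((ln 2 / 2 - eps) * (ln n%:R / ln (ln n%:R)))
        <= (hP n)%:R :> R).
Proof.
split=> [n _|eps eps0]; first exact: hP_leq_F.
(* Shrinking eps only strengthens the bound; the cap 1/4 is the one required by [hP_lower_bound]. *)
pose e := Num.min eps (1 / 4).
have e0 : 0 < e by rewrite lt_min eps0; lra.
have e4 : e <= 1 / 4 by rewrite ge_min lexx orbT.
(* The threshold for ln (ln n), whence n0 just above exp(exp b). *)
pose b := 128 / e ^+ 2.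
have b0 : 0 < b by rewrite divr_gt0 // exprn_gt0.
exists (Num.truncn (expR (expR b))).+1 => n; rewrite truncn_lt_nat ?expR_ge0 // => hn.
have n0 : 0 < n%:R :> R by apply: lt_trans hn; rewrite expR_gt0.
have ln_n : expR b < ln n%:R by rewrite -ltr_expR lnK ?posrE.
have ln0 : 0 < ln n%:R :> R by apply: lt_trans ln_n; rewrite expR_gt0.
have ln_ln : b < ln (ln n%:R) by rewrite -ltr_expR lnK ?posrE.
have := @hP_lower_bound R e (ln (ln n%:R)) n e0 e4.
rewrite !lnK ?posrE // => /(_ _ erefl) h; apply: le_trans (h _).
  rewrite ler_pM2l // ler_expR ler_wpM2r ?divr_ge0 ?(ltW ln0) //.
    by rewrite ltW // (lt_trans b0).
  by rewrite lerB // ge_min lexx.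
have -> : 128 = e ^+ 2 * b by rewrite /b; field; rewrite gt_eqF.
by rewrite ler_pM2l ?exprn_gt0 // ltW.
Qed.
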